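(* For all integers $n\ge 1$ and $k\ge 0$, $$\int_{U(n)}|\det(g-I)|^{2k}\,dg=\prod_{j=0}^{n-1}\frac{j!\,(j+2k)!}{\big((j+k)!\big)^2}.$$
   Context: $U(n)$ is the group of $n\times n$ unitary matrices and $dg$ is Haar measure normalized to total volume $1$. *)

(* Defs.v *)
From HB Require Import structures.
From mathcomp Require Import all_boot all_order all_algebra spectral.
From mathcomp Require Import all_classical all_reals all_analysis.
From mathcomp.real_closed Require Import complex.

Set Implicit Arguments.
Unset Strict Implicit.
Unset Printing Implicit Defensive.

Import Order.TTheory GRing.Theory Num.Theory.
Import numFieldNormedType.Exports.

Local Open Scope classical_set_scope.
Local Open Scope ring_scope.
Local Open Scope complex_scope.

(* R[i] with the topology of its modulus; the library only provides this
   structure on the alias R[i]^o. *)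
HB.instance Definition _ (R : rcfType) := NormedModule.copy R[i] R[i]^o.

Definition unitary (R : realType) (n : nat) : Type :=
  {g : 'M[R[i]]_n | g \is unitarymx}.

HB.instance Definition _ (R : realType) (n : nat) :=
  SubChoice.copy (unitary R n) {g : 'M[R[i]]_n | g \is unitarymx}.

Section UnitaryGroup.
Variables (R : realType) (n : nat).
Implicit Types g h : unitary R n.

Lemma unitarymx1 : (1%:M : 'M[R[i]]_n) \is unitarymx.
Proof. by apply/unitarymxP; rewrite trmx1 map_mx1 mulmx1. Qed.

Lemma unitarymxtC g : map_mx Num.conj (\val g)^T \is unitarymx.
Proof. by rewrite trmxC_unitary (valP g). Qed.

Definition unitary_one : unitary R n := Sub 1%:M unitarymx1.
Definition unitary_mul g h : unitary R n :=
  Sub (\val g *m \val h) (mul_unitarymx (valP g) (valP h)).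
Definition unitary_inv g : unitary R n :=
  Sub (map_mx Num.conj (\val g)^T) (unitarymxtC g).

Lemma unitary_mulA : associative unitary_mul.
Proof. by move=> f g h; apply/val_inj; rewrite !SubK mulmxA. Qed.

Lemma unitary_mul1g : left_id unitary_one unitary_mul.
Proof. by move=> g; apply/val_inj; rewrite !SubK mul1mx. Qed.

Lemma unitary_mulg1 : right_id unitary_one unitary_mul.
Proof. by move=> g; apply/val_inj; rewrite !SubK mulmx1. Qed.

Lemma unitary_mulgV : right_inverse unitary_one unitary_inv unitary_mul.
Proof. by move=> g; apply/val_inj; rewrite !SubK; apply/unitarymxP/(valP g). Qed.

Lemma unitary_mulVg : left_inverse unitary_one unitary_inv unitary_mul.
Proof.
move=> g; apply/val_inj; rewrite !SubK; apply: mulmx1C.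
exact/unitarymxP/(valP g).
Qed.

HB.instance Definition _ := isGroup.Build (unitary R n)
  unitary_mulA unitary_mul1g unitary_mulg1 unitary_mulVg unitary_mulgV.

HB.instance Definition _ := isPointed.Build (unitary R n) unitary_one.

HB.instance Definition _ := Topological.copy (unitary R n)
  (initial_topology (\val : unitary R n -> 'M[R[i]]_n)).

End UnitaryGroup.

Definition borel_unitary (R : realType) (n : nat) :=
  g_sigma_algebraType (@open (unitary R n)).

HB.instance Definition _ (R : realType) (n : nat) :=
  Measurable.on (borel_unitary R n).

(* Haar measure of total volume 1: the Borel probability measure invariant under
   left translations.  On the compact metrizable group U(n) finite Borel measures
   are automatically regular, so no regularity condition is imposed, and such a
   measure exists, is unique and is also right-invariant. *)
Definition haar_probability (R : realType) (n : nat)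
    (mu : probability (borel_unitary R n) R) : Prop :=
  forall (h : unitary R n) (A : set (borel_unitary R n)), measurable A ->
    mu [set (h * g)%g | g in (A : set (unitary R n))] = mu A.

(* Main.v *)
Require Import Defs.
From mathcomp Require Import all_boot all_order all_algebra.
From mathcomp Require Import spectral ring.
From mathcomp Require Import all_classical all_reals all_analysis.
From mathcomp Require Import measurable_realfun.
From mathcomp.real_closed Require Import complex.

(* Write g = [[A, B], [C, D]] in U(1 + m) with A a scalar.  The Schur complement
   t(g) = D + C B / (1 - A) is again unitary and
   det (1 - g) = (1 - A) det (1 - t(g)).  Moreover t(diag(1, h) g) = h t(g), while
   diag(1, h) does not change A.  So if g is a left-invariant random unitary
   matrix, then t(g) is left-invariant too, and averaging over
   diag(1, t(g')) g with g' an independent copy of g shows that A and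
   |det (1 - t(g))| are independent, since det (1 - xy) = det (1 - yx).  Hence
   E |det (1 - g)|^2k = E |1 - A|^2k * E |det (1 - t(g))|^2k, which is iterated.

   The factor E |1 - A|^2k is the sum of C(k, i)^2 E |A|^2i, by invariance under
   phases.  Reflections in the plane of two coordinates, together with the fact
   that the first column has norm 1, give E |A|^2i = i! m! / (m + i)!, and the
   sum over i is Vandermonde's convolution. *)

Set Implicit Arguments.
Unset Strict Implicit.
Unset Printing Implicit Defensive.

Import Order.TTheory GRing.Theory Num.Theory.
Import numFieldNormedType.Exports.
Local Open Scope classical_set_scope.
Local Open Scope ring_scope.
Local Notation normc := Normc.normc.

(** * The Schur complement of a unitary matrix *)

Definition det1B (R : realType) m (A : 'M[R[i]]_m) : R[i] := \det (1%:M - A).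

(** Conjugation by [a] carries [1 - b a] to [1 - a b]. *)
Lemma det1B_mulC (R : realType) m (a b : 'M[R[i]]_m) : a \in unitmx ->
  det1B (a *m b) = det1B (b *m a).
Proof.
move=> aU; rewrite /det1B.
have -> : 1%:M - a *m b = a *m (1%:M - b *m a) *m invmx a.
  by rewrite mulmxBr mulmx1 mulmxBl mulmxV// !mulmxA mulmxK.
by rewrite !det_mulmx det_inv mulrAC divff ?mul1r// -unitfE -unitmxE.
Qed.

Section Transfer.
Variables (R : realType) (m : nat).
Local Open Scope sesquilinear_scope.
Local Notation C := R[i].
Implicit Types g : 'M[C]_(1 + m).

(** Since [0^-1 = 0], this is the lower right block when [g 0 0 = 1]. The lemmas below cover that
    case as well, so no null set has to be removed later. *)
Definition transfer g : 'M[C]_m :=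
  drsubmx g + (1 - g 0 0)^-1 *: (dlsubmx g *m ursubmx g).

Lemma transfer_mulmx g (h : 'M[C]_m) :
  transfer (block_mx 1%:M 0 0 h *m g) = h *m transfer g.
Proof.
rewrite -[g in LHS](submxK g) mulmx_block !mul1mx !mul0mx !addr0 !add0r.
rewrite /transfer block_mxKdr block_mxKdl block_mxKur mulmxDr -scalemxAr mulmxA.
congr (_ + (1 - _)^-1 *: _).
have -> : 0 = lshift m (0 : 'I_1) by apply: val_inj.
by rewrite -[in RHS](submxK g) !block_mxEul.
Qed.

(** The first row has norm 1, and its corner already uses all of it. This handles the degenerate
    case of [transfer]. *)
Lemma unitary_corner1 g : g \is unitarymx -> g 0 0 = 1 -> ursubmx g = 0.
Proof.
move=> /unitarymxP /matrixP /(_ 0 0); rewrite !mxE eqxx big_split_ord big_ord1 /=.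
rewrite (_ : lshift _ _ = 0 :> 'I_(1 + m)); last exact/val_inj.
move=> + g1; rewrite !mxE g1 rmorph1 mulr1 -[RHS]addr0 => /addrI /eqP.
rewrite psumr_eq0; last first.
  by move=> i _; rewrite !mxE mul_conjC_ge0.
move=> /allP g0; apply/matrixP => i j; rewrite ord1 !mxE.
have := g0 j (mem_index_enum _); rewrite !mxE /= mul_conjC_eq0 => /eqP.
by rewrite (_ : lshift _ _ = 0 :> 'I_(1 + m))//; exact/val_inj.
Qed.

(* The columns of [col_mx b 1%:M] span the graph on which the system
   [(x, u) |-> g (x, u) = (x, transfer g u)] feeds its first output back into
   its first input. *)
Lemma transfer_feedback g : g \is unitarymx ->
  let b := (1 - g 0 0)^-1 *: ursubmx g in
  g *m col_mx b 1%:M = col_mx b (transfer g).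
Proof.
move=> gU b; rewrite -[in LHS](submxK g) mul_block_col !mulmx1.
congr col_mx; last by rewrite /b /transfer -scalemxAr addrC.
have -> : ulsubmx g = (g 0 0)%:M.
  by apply/matrixP => i j; rewrite !ord1 !mxE eqxx mulr1n !lshift0.
rewrite mul_scalar_mx /b scalerA; have [g1|g1] := eqVneq (g 0 0) 1.
  by rewrite unitary_corner1// !scaler0 addr0.
(* What remains is [a / (1 - a) + 1 = 1 / (1 - a)] for the corner [a]. *)
rewrite -[X in _ + X]scale1r -scalerDl; congr (_ *: _).
have {}g1 : 1 - g 0 0 != 0 by rewrite subr_eq0 eq_sym.
by apply: (mulIf g1); rewrite mulrDl mulfVK// mul1r addrC subrK mulVf.
Qed.

(** As [g] preserves Gram matrices, the feedback identity gives [b^* b + 1 = b^* b + t^* t] with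
    [t = transfer g], and [b^* b] cancels. *)
Lemma transfer_unitary g : g \is unitarymx -> transfer g \is unitarymx.
Proof.
move=> gU; have := transfer_feedback gU; set b := _ *: _ => /= gb.
have gg : g^t* *m g = 1%:M by apply: mulmx1C; exact/unitarymxP.
have := congr1 (fun A : 'M[C]_(1 + m, m) => A^t* *m A) gb.
rewrite /= trmx_mul map_mxM mulmxA -[_ *m g^t* *m g]mulmxA gg mulmx1.
rewrite !tr_col_mx !map_row_mx !mul_row_col => /addrI.
rewrite trmx1 map_mx1 mulmx1 => hh.
by apply/unitarymxP; apply: mulmx1C.
Qed.

(** By the feedback identity, [1 - g] sends [col_mx b 1] to [col_mx 0 (1 - transfer g)]. Hence a
    unipotent factor on the right makes [1 - g] block lower triangular. *)
Lemma det1B_transfer g : g \is unitarymx ->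
  det1B g = (1 - g 0 0) * det1B (transfer g).
Proof.
rewrite /det1B.
move=> gU; have := transfer_feedback gU; set b := _ *: _ => /= gb.
have : (1%:M - g) *m block_mx 1%:M b 0 1%:M =
    block_mx (1%:M - ulsubmx g) 0 (- dlsubmx g) (1%:M - transfer g).
  rewrite -[in LHS](submxK g) (scalar_mx_block 1 m) opp_block_mx add_block_mx.
  move: gb; rewrite -[in LHS](submxK g) mul_block_col => /eq_col_mx[].
  rewrite mulmx1 => b0; rewrite mulmx1 => bt.
  rewrite !sub0r mulmx_block !mulmx1 !mulmx0 !addr0; congr block_mx.
    by rewrite mulmxBl mul1mx -{1}b0 addrAC addrK subrr.
  by rewrite -bt opprD addrCA mulNmx.
move=> /(congr1 determinant); rewrite det_mulmx det_ublock !det1 !mulr1 => ->.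
rewrite det_lblock det_mx11 !mxE eqxx mulr1n; congr ((1 - _) * _).
by congr (g _ _); exact/val_inj.
Qed.

End Transfer.

(** * Averages over roots of unity *)

Section RootsOfUnity.
Variable C : numClosedFieldType.

(** A [2 ^ n]-th root of -1 has order dividing [2 ^ n.+1] but not [2 ^ n]. Only primitive roots of
    arbitrarily large order are needed. *)
Lemma prim_root_2exp n : {z : C | (2 ^ n.+1).-primitive_root z}.
Proof.
pose z : C := (2 ^ n).-root (-1).
have zn : z ^+ (2 ^ n) = -1 by rewrite rootCK// expn_gt0.
have z1 : z ^+ (2 ^ n.+1) = 1 by rewrite expnSr exprM zn sqrrN expr1n.
exists z; have [|d zd] := prim_order_exists _ z1; first by rewrite expn_gt0.
move=> /dvdn_pfactor[]// e; rewrite leq_eqVlt => /orP[/eqP-> <-//|en] dE.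
have : z ^+ (2 ^ n) = 1.
  by apply/eqP; rewrite -(prim_order_dvd zd) dE dvdn_exp2l.
by rewrite zn => /eqP; rewrite eq_sym -subr_eq0 opprK -mulr2n pnatr_eq0.
Qed.

Lemma norm_prim_root N (w : C) : (0 < N)%N -> N.-primitive_root w -> `|w| = 1.
Proof.
move=> N0 wN; apply/eqP; rewrite -(pexpr_eq1 N0)//.
by rewrite -normrX (prim_expr_order wN) normr1.
Qed.

(** Parseval's identity on the cyclic group of order [N], from the orthogonality of its
    characters. *)
Lemma prim_root_parseval N (w : C) (c : nat -> C) : (0 < N)%N ->
  N.-primitive_root w ->
  \sum_(j < N) `|\sum_(i < N) c i * w ^+ (j * i)| ^+ 2 =
  N%:R * \sum_(i < N) `|c i| ^+ 2.
Proof.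
move=> N0 wN; have w1 := norm_prim_root N0 wN.
have ww : w * w^* = 1 by rewrite -normCK w1 expr1n.
have wsum (i l : 'I_N) : \sum_(j < N) (w ^+ i * w^* ^+ l) ^+ j = (i == l)%:R * N%:R.
  have [->|il] := eqVneq i l.
    under eq_bigr do rewrite -exprMn ww !expr1n.
    by rewrite sumr_const card_ord mul1r.
  (* The ratio [q] of the geometric sum is not 1, while [q ^+ N = 1], so the sum vanishes. *)
  have q1 : w ^+ i * w^* ^+ l - 1 != 0.
    apply: contra il; rewrite subr_eq0 => /eqP q1; rewrite -val_eqE /=.
    rewrite -(modn_small (ltn_ord i)) -[X in _ == X](modn_small (ltn_ord l)).
    rewrite -(eq_prim_root_expr wN); apply/eqP.
    by rewrite -[RHS]mul1r -q1 -mulrA -exprMn mulrC [w^* * w]mulrC ww expr1n mul1r.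
  rewrite mul0r; apply: (mulfI q1); rewrite -subrX1 mulr0 exprMn -!exprM.
  rewrite ![(_ * N)%N]mulnC !exprM (prim_expr_order wN) -rmorphXn.
  by rewrite (prim_expr_order wN) rmorph1 !expr1n mulr1 subrr.
under eq_bigr => j _.
  rewrite normCK rmorph_sum big_distrlr /=.
  under eq_bigr => i _ do under eq_bigr => l _ do
    rewrite rmorphM rmorphXn mulrACA !exprM exprAC [w^* ^+ _ ^+ _]exprAC -exprMn.
  over.
rewrite exchange_big mulr_sumr; apply: eq_bigr => i _ /=.
rewrite exchange_big (bigD1 i)//= [X in _ + X]big1 ?addr0.
  by rewrite -mulr_sumr wsum eqxx mul1r mulrC normCK.
by move=> l li; rewrite -mulr_sumr wsum eq_sym (negbTE li) mul0r mulr0.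
Qed.

(* [N] exceeds the degree, so averaging over rotations of [x] kills every mixed
   term of the expansion of [|x + y| ^ 2k]. *)
Lemma mean_norm_rotation N (w x y : C) k : (k < N)%N -> N.-primitive_root w ->
  \sum_(j < N) `|w ^+ j * x + y| ^+ (2 * k) =
  N%:R * \sum_(i < k.+1) 'C(k, i)%:R ^+ 2 * (`|x| ^+ (2 * i) * `|y| ^+ (2 * (k - i))).
Proof.
move=> kN wN.
(* The coefficients of [(w ^+ j * x + y) ^+ k] in powers of [w ^+ j], padded with zeros up to
   [N]. *)
pose c i := if (i < k.+1)%N then 'C(k, i)%:R * (x ^+ i * y ^+ (k - i)) else 0.
have N0 := leq_trans (ltn0Sn _) kN.
transitivity (\sum_(j < N) `|\sum_(i < N) c i * w ^+ (j * i)| ^+ 2).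
  apply: eq_bigr => j _; rewrite mulnC exprM -normrX addrC exprDn; congr (`|_| ^+ _).
  rewrite (big_ord_widen _ (fun i => (y ^+ (k - i) * (w ^+ j * x) ^+ i) *+ 'C(k, i)) kN).
  rewrite big_mkcond/=; apply: eq_bigr => i _.
  rewrite /c; case: ifP; last by rewrite mul0r.
  by rewrite exprMn -exprM -mulr_natl => _; ring.
rewrite prim_root_parseval//; congr (_ * _).
rewrite (big_ord_widen _ (fun i => 'C(k, i)%:R ^+ 2 *
  (`|x| ^+ (2 * i) * `|y| ^+ (2 * (k - i)))) kN) [RHS]big_mkcond/=.
apply: eq_bigr => i _; rewrite /c; case: ifP; last by rewrite normr0 expr0n.
by rewrite !normrM !normrX !exprMn -!exprM normr_nat ![(_ * 2)%N]mulnC.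
Qed.

End RootsOfUnity.

(** * Polynomial identities tested at squares *)

Section PolynomialCoefficient.
Variable F : numFieldType.

Lemma coef1M (p q : {poly F}) : (p * q)`_1 = p`_0 * q`_1 + p`_1 * q`_0.
Proof. by rewrite coefM !big_ord_recl big_ord0 addr0. Qed.

Lemma coef01X (p : {poly F}) N : p`_0 = 1 -> (p ^+ N)`_0 = 1 /\ (p ^+ N)`_1 = p`_1 *+ N.
Proof.
move=> p0; elim: N => [|N [IH0 IH1]]; first by rewrite expr0 !coef1.
by rewrite exprS coef0M coef1M p0 IH0 IH1 !mulr1 !mul1r mulrSr.
Qed.

(** The first [size p] squares are distinct in characteristic 0, which is one root too many for a
    nonzero [p]. *)
Lemma poly_eq0_squares (p : {poly F}) : (forall n, p.[(n ^ 2)%:R] = 0) -> p = 0.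
Proof.
move=> p0; apply/eqP/negPn/negP => pn0.
have := max_poly_roots pn0 (rs := [seq (n ^ 2)%:R | n <- iota 0 (size p)]).
rewrite size_map size_iota ltnn => H; suff : false by []; apply: H.
  by apply/allP => _ /mapP[n _ ->]; apply/rootP.
rewrite map_inj_uniq ?iota_uniq// => a b /eqP; rewrite eqr_nat eqn_exp2r//.
by move=> /eqP.
Qed.

(* Comparing the coefficients of [X], after division by [j.+1]. *)
Lemma rotation_coef (m : nat -> F) j :
  (forall n : nat, let b := (n ^ 2)%:R in
   \sum_(i < j.+2) 'C(j.+1, i)%:R ^+ 2 *
     ((1 - b) ^+ (2 * i) * (4 * b) ^+ (j.+1 - i) * m i) =
   (1 + b) ^+ (2 * j.+1) * m j.+1) ->
  j.+1%:R * m j = m j.+1.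
Proof.
move=> H.
pose p i : {poly F} := (1 - 'X) ^+ (2 * i) * (4%:R *: 'X) ^+ (j.+1 - i).
pose q : {poly F} := \sum_(i < j.+2) ('C(j.+1, i)%:R ^+ 2 * m i) *: p i
  - m j.+1 *: (1 + 'X) ^+ (2 * j.+1).
have q0 : q = 0.
  apply: poly_eq0_squares => n; rewrite /q !hornerE horner_sum.
  apply/eqP; rewrite subr_eq0 [eqbRHS]mulrC -H; apply/eqP/eq_bigr => i _.
  rewrite /p hornerZ hornerM !horner_exp hornerZ hornerX hornerD hornerN.
  by rewrite hornerX hornerC; ring.
have [Xm0 Xm1] : (1 - 'X : {poly F})`_0 = 1 /\ (1 - 'X : {poly F})`_1 = -1.
  by rewrite !coefB !coef1 !coefX/= subr0 sub0r.
have [Xp0 Xp1] : (1 + 'X : {poly F})`_0 = 1 /\ (1 + 'X : {poly F})`_1 = 1.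
  by rewrite !coefD !coef1 !coefX/= addr0 add0r.
have : q`_1 = 0 by rewrite q0 coef0.
(* Only [i = j] and [i = j.+1] contribute: for smaller [i], [p i] is divisible by ['X ^+ 2]. *)
rewrite /q coefB coefZ (coef01X _ Xp0).2 Xp1 coef_sum !big_ord_recr /= big1; last first.
  move=> i _; rewrite coefZ /p exprZn -scalerAr coefZ coefMXn.
  by rewrite ltn_subRL addn1 ltnS ltn_ord !mulr0.
rewrite !coefZ /p subnn subSnn expr0 mulr1 expr1 coef1M coefZ coefX.
rewrite !(coef01X _ Xm0).2 !(coef01X _ Xm0).1 Xm1 coefZ coefX /=.
rewrite binn binSn !mulr0 mulr1 addr0 add0r => E.
(* With [J = j.+1], the coefficient [E] is [4 J^2 m_j - 2 J m_J - 2 J m_J], so [4 J] can be divided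
   out. *)
have J0 : 4 * j.+1%:R != 0 :> F by rewrite mulf_neq0 ?pnatr_eq0.
apply/eqP; rewrite -subr_eq0 -(mulrI_eq0 _ (mulfI J0)) -E natrM mulNrn natrM.
by apply/eqP; ring.
Qed.

End PolynomialCoefficient.

(** * Phases and reflections *)

Lemma block1_unitary (R : realType) m (h : 'M[R[i]]_m) :
  h \is unitarymx -> block_mx (1%:M : 'M[R[i]]_1) 0 0 h \is unitarymx.
Proof.
move=> /unitarymxP hU; apply/unitarymxP.
rewrite tr_block_mx map_block_mx !trmx0 trmx1 !map_mx0 map_mx1 mulmx_block.
by rewrite !mulmx0 !mul0mx !mulmx1 !addr0 !add0r hU -scalar_mx_block.
Qed.

Section TestMatrices.
Variables (R : realType) (m : nat).
Local Open Scope sesquilinear_scope.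
Local Notation C := R[i].
Implicit Types g : 'M[C]_(1 + m).

Definition phase_mx (w : C) : 'M[C]_(1 + m) := block_mx w%:M 0 0 1%:M.

Lemma phase_unitary w : `|w| = 1 -> phase_mx w \is unitarymx.
Proof.
move=> w1; apply/unitarymxP; rewrite /phase_mx.
rewrite tr_block_mx map_block_mx !trmx0 trmx1 !map_mx0 map_mx1 mulmx_block.
rewrite !mulmx0 !mul0mx !mulmx1 !addr0 !add0r tr_scalar_mx map_scalar_mx.
by rewrite -scalar_mxM -normCK w1 expr1n -scalar_mx_block.
Qed.

Lemma phase_mx0 w g : (phase_mx w *m g) 0 0 = w * g 0 0.
Proof.
have -> : 0 = lshift m (0 : 'I_1) :> 'I_(1 + m) by exact: val_inj.
rewrite -[in LHS](submxK g) /phase_mx mulmx_block block_mxEul !mul0mx addr0.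
by rewrite mul_scalar_mx !mxE.
Qed.

Lemma phase_mxr w g l : (phase_mx w *m g) (rshift 1 l) 0 = g (rshift 1 l) 0.
Proof.
have -> : 0 = lshift m (0 : 'I_1) :> 'I_(1 + m) by exact: val_inj.
rewrite -[in LHS](submxK g) /phase_mx mulmx_block block_mxEdl !mul0mx add0r.
by rewrite mul1mx !mxE.
Qed.

Definition axis l (b : nat) : 'cV[C]_(1 + m) :=
  delta_mx 0 0 + b%:R *: delta_mx (rshift 1 l) 0.

(** The Householder reflection in the hyperplane orthogonal to [axis l b], whose squared norm is
    [1 + b^2]. Natural values of [b] keep it real and are numerous enough to determine a
    polynomial. *)
Definition reflection_mx l b : 'M[C]_(1 + m) :=
  1%:M - (2 / (1 + b%:R ^+ 2)) *: (axis l b *m (axis l b)^T).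

Lemma axis_real l b : map_mx Num.conj (axis l b) = axis l b.
Proof.
apply/matrixP => i j; rewrite !mxE rmorphD rmorphM !rmorph_nat.
by congr (_%:R + _ * _); rewrite rmorph_nat.
Qed.

Lemma axis_dot n l b (A : 'M[C]_(1 + m, n)) j :
  ((axis l b)^T *m A) 0 j = A 0 j + b%:R * A (rshift 1 l) j.
Proof.
by rewrite /axis linearD linearZ /= !trmx_delta mulmxDl -scalemxAl -!rowE !mxE.
Qed.

Lemma axis_norm2 l b : (axis l b)^T *m axis l b = (1 + b%:R ^+ 2)%:M.
Proof.
apply/matrixP => i j; rewrite !ord1 axis_dot !mxE !eqxx /= mulr1n.
by rewrite !mulr0 !mulr1 addr0 add0r expr2.
Qed.

Lemma sqr_nat1_neq0 b : 1 + b%:R ^+ 2 != 0 :> C.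
Proof. by rewrite -natrX -(natrD _ 1) pnatr_eq0. Qed.

Lemma reflection_unitary l b : reflection_mx l b \is unitarymx.
Proof.
apply/unitarymxP; rewrite /reflection_mx.
set c := 2 / _; set u := axis l b.
have cr : c^* = c.
  by rewrite /c !(rmorphM, rmorphD, rmorphXn, fmorphV, rmorph_nat, rmorph1).
have -> : (1%:M - c *: (u *m u^T))^t* = 1%:M - c *: (u *m u^T).
  rewrite linearB linearZ /= trmx1 trmx_mul trmxK map_mxB map_mx1 map_mxZ map_mxM.
  by rewrite /= cr -map_trmx axis_real.
rewrite mulmxBl mul1mx mulmxBr mulmx1 -!scalemxAl -scalemxAr -mulmxA.
rewrite (mulmxA _ u) axis_norm2 mul_scalar_mx -scalemxAr !scalerA.
rewrite -!addrA -opprD -scalerBl -scalerDl.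
(* The square of [u u^T] is [(1 + b^2) u u^T], and [c (1 + b^2) = 2]. *)
have -> : c + (c - c * (c * (1 + b%:R ^+ 2))) = 0.
  by rewrite [c * (1 + _)]divfK ?sqr_nat1_neq0//; ring.
by rewrite scale0r subr0.
Qed.

(** The denominator is cleared so that the resulting moment identity is polynomial in [b^2]. *)
Lemma reflection_mx0 l b g : (1 + b%:R ^+ 2) * (reflection_mx l b *m g) 0 0 =
  - ((1 - b%:R ^+ 2) * g 0 0 + 2 * b%:R * g (rshift 1 l) 0).
Proof.
rewrite /reflection_mx mulmxBl mul1mx -scalemxAl -mulmxA !mxE big_ord1 axis_dot.
rewrite !mxE /= mulr0 addr0.
by field; exact: sqr_nat1_neq0.
Qed.

Lemma unitary_col_norm2 n (g : 'M[C]_n) j : g \is unitarymx ->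
  \sum_i `|g i j| ^+ 2 = 1.
Proof.
move=> /unitarymxP /mulmx1C /matrixP /(_ j j); rewrite !mxE eqxx => gj.
by rewrite -[RHS]gj; apply: eq_bigr => i _; rewrite !mxE normCK mulrC.
Qed.

End TestMatrices.

(** * Measurability *)

Definition cmeasurable (R : realType) d (T : measurableType d) (Z : T -> R[i]) :=
  measurable_fun setT (fun x => complex.Re (Z x)) /\
  measurable_fun setT (fun x => complex.Im (Z x)).

Section ComplexMeasurable.
Variables (R : realType) (d : measure_display) (T : measurableType d).
Implicit Types Z W : T -> R[i].

Lemma cmeasurable_cst (c : R[i]) : cmeasurable (fun _ : T => c).
Proof. by split; exact: measurable_cst. Qed.

Lemma cmeasurableD Z W : cmeasurable Z -> cmeasurable W ->
  cmeasurable (fun x => Z x + W x).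
Proof.
move=> [Zr Zi] [Wr Wi]; split.
  rewrite (_ : (fun x => _) = (fun x => complex.Re (Z x) + complex.Re (W x))).
    exact: measurable_funD.
  by apply/funext => x; case: (Z x) (W x) => [a b] [].
rewrite (_ : (fun x => _) = (fun x => complex.Im (Z x) + complex.Im (W x))).
  exact: measurable_funD.
by apply/funext => x; case: (Z x) (W x) => [a b] [].
Qed.

Lemma cmeasurableM Z W : cmeasurable Z -> cmeasurable W ->
  cmeasurable (fun x => Z x * W x).
Proof.
move=> [Zr Zi] [Wr Wi]; split.
  rewrite (_ : (fun x => _) = (fun x => complex.Re (Z x) * complex.Re (W x) -
                                       complex.Im (Z x) * complex.Im (W x))).
    by apply: measurable_funB; exact: measurable_funM.
  by apply/funext => x; case: (Z x) (W x) => [a b] [].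
rewrite (_ : (fun x => _) = (fun x => complex.Re (Z x) * complex.Im (W x) +
                                     complex.Im (Z x) * complex.Re (W x))).
  by apply: measurable_funD; exact: measurable_funM.
by apply/funext => x; case: (Z x) (W x) => [a b] [].
Qed.

Lemma cmeasurableN Z : cmeasurable Z -> cmeasurable (fun x => - Z x).
Proof.
move=> mZ; under eq_fun do rewrite -mulN1r.
by apply: cmeasurableM => //; exact: cmeasurable_cst.
Qed.

Lemma cmeasurableV Z : cmeasurable Z -> cmeasurable (fun x => (Z x)^-1).
Proof.
move=> [Zr Zi].
(* The inverse is the conjugate over the squared modulus. The real power is measurable and agrees
   with the inverse even at 0, where both are 0. *)
pose N x : R := (complex.Re (Z x) ^+ 2 + complex.Im (Z x) ^+ 2) `^ (-1).
have NE x : N x = (complex.Re (Z x) ^+ 2 + complex.Im (Z x) ^+ 2)^-1.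
  by rewrite /N powR_inv1// addr_ge0// sqr_ge0.
have mN : measurable_fun setT N.
  apply: (@measurableT_comp _ _ _ _ _ _ (@powR R ^~ (-1))) => //.
  by apply: measurable_funD; exact: measurable_funX.
split.
  rewrite (_ : (fun x => _) = (fun x => complex.Re (Z x) * N x)).
    exact: measurable_funM.
  by apply/funext => x; rewrite NE; case: (Z x) => [a b].
rewrite (_ : (fun x => _) = (fun x => - (complex.Im (Z x) * N x))).
  by apply: measurable_funN; exact: measurable_funM.
by apply/funext => x; rewrite NE; case: (Z x) => [a b].
Qed.

Lemma cmeasurable_sum I (s : seq I) (Z : I -> T -> R[i]) :
  (forall i, cmeasurable (Z i)) -> cmeasurable (fun x => \sum_(i <- s) Z i x).
Proof.
move=> mZ; elim: s => [|i s ih].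
  by under eq_fun do rewrite big_nil; exact: cmeasurable_cst.
by under eq_fun do rewrite big_cons; exact: cmeasurableD.
Qed.

Lemma cmeasurable_prod I (s : seq I) (Z : I -> T -> R[i]) :
  (forall i, cmeasurable (Z i)) -> cmeasurable (fun x => \prod_(i <- s) Z i x).
Proof.
move=> mZ; elim: s => [|i s ih].
  by under eq_fun do rewrite big_nil; exact: cmeasurable_cst.
by under eq_fun do rewrite big_cons; exact: cmeasurableM.
Qed.

Lemma measurable_normc Z : cmeasurable Z -> measurable_fun setT (fun x => normc (Z x)).
Proof.
move=> [Zr Zi]; rewrite (_ : (fun x => _) =
  (fun x => Num.sqrt (complex.Re (Z x) ^+ 2 + complex.Im (Z x) ^+ 2))); last first.
  by apply/funext => x; case: (Z x).
apply: (@measurableT_comp _ _ _ _ _ _ (@Num.sqrt R)).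
  by apply: continuous_measurable_fun; exact: sqrt_continuous.
by apply: measurable_funD; exact: measurable_funX.
Qed.

End ComplexMeasurable.

Definition mxmeasurable (R : realType) d (T : measurableType d) m n
    (X : T -> 'M[R[i]]_(m, n)) :=
  forall i j, cmeasurable (fun x => X x i j).

Section MatrixMeasurable.
Variables (R : realType) (d : measure_display) (T : measurableType d).

Lemma mxmeasurable_cst m n (A : 'M[R[i]]_(m, n)) : mxmeasurable (fun _ : T => A).
Proof. by move=> i j; exact: cmeasurable_cst. Qed.

Lemma mxmeasurableM m n p (X : T -> 'M[R[i]]_(m, n)) (Y : T -> 'M[R[i]]_(n, p)) :
  mxmeasurable X -> mxmeasurable Y -> mxmeasurable (fun x => X x *m Y x).
Proof.
move=> mX mY i j; under eq_fun do rewrite mxE.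
by apply: cmeasurable_sum => k; exact: cmeasurableM.
Qed.

Lemma mxmeasurableB m n (X Y : T -> 'M[R[i]]_(m, n)) :
  mxmeasurable X -> mxmeasurable Y -> mxmeasurable (fun x => X x - Y x).
Proof.
move=> mX mY i j; under eq_fun do rewrite !mxE.
by apply: cmeasurableD => //; exact: cmeasurableN.
Qed.

Lemma cmeasurable_det m (X : T -> 'M[R[i]]_m) :
  mxmeasurable X -> cmeasurable (fun x => \det (X x)).
Proof.
move=> mX; rewrite /determinant; apply: cmeasurable_sum => s.
apply: cmeasurableM; first exact: cmeasurable_cst.
by apply: cmeasurable_prod => i; exact: mX.
Qed.

Lemma mxmeasurable_transfer m (X : T -> 'M[R[i]]_(1 + m)) :
  mxmeasurable X -> mxmeasurable (fun x => transfer (X x)).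
Proof.
move=> mX i j; under eq_fun do rewrite !mxE.
apply: cmeasurableD; first exact: mX.
apply: cmeasurableM.
  apply: cmeasurableV; apply: cmeasurableD; first exact: cmeasurable_cst.
  by apply: cmeasurableN; exact: mX.
apply: cmeasurable_sum => k; under eq_fun do rewrite !mxE.
by apply: cmeasurableM; exact: mX.
Qed.

End MatrixMeasurable.

(* Matrices carry no measurable structure here, so Borel measurability of [f] is
   tested against all maps into matrices with measurable entries. *)
Definition mx_borel (R : realType) m n (f : 'M[R[i]]_(m, n) -> R) :=
  forall d (T : measurableType d) (X : T -> 'M[R[i]]_(m, n)),
    mxmeasurable X -> measurable_fun setT (fun x => f (X x)).

(** Invariance in law is stated for a random matrix rather than for a measure on matrices, so that
    it passes to [transfer] on the same probability space. *)
Definition left_invariant (R : realType) d (T : measurableType d)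
    (mu : {measure set T -> \bar R}) m (X : T -> 'M[R[i]]_m) :=
  forall (f : 'M[R[i]]_m -> R) (h : 'M[R[i]]_m),
    mx_borel f -> (forall A, 0 <= f A) -> h \is unitarymx ->
  (\int[mu]_x (f (h *m X x))%:E = \int[mu]_x (f (X x))%:E)%E.

(** * Factorization of the determinant moments *)

Section Factorization.
Variables (R : realType) (d : measure_display) (T : measurableType d).
Variables (mu : probability T R).

(** Invariance of [X] under [diag(1, h)] is applied to the test function [f] composed with
    [transfer]. *)
Lemma left_invariant_transfer m (X : T -> 'M[R[i]]_(1 + m)) :
  left_invariant mu X -> left_invariant mu (fun x => transfer (X x)).
Proof.
move=> Xinv f h mf f0 hU.
rewrite -(Xinv (fun A => f (transfer A)) _ _ _ (block1_unitary hU))//.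
  by apply: eq_integral => x _; rewrite transfer_mulmx.
by move=> d' T' Y mY; apply: mf; exact: mxmeasurable_transfer.
Qed.

Lemma normc_det1B_borel m k : mx_borel (fun A : 'M[R[i]]_m =>
  normc (det1B A) ^+ k).
Proof.
move=> d' T' Y mY; apply: measurable_funX; apply: measurable_normc.
by apply: cmeasurable_det; apply: mxmeasurableB => //; exact: mxmeasurable_cst.
Qed.

Lemma normc_ge0 (z : R[i]) : 0 <= normc z.
Proof. by case: z => a b; exact: sqrtr_ge0. Qed.

(** The function [G] of two independent copies is integrated in both orders: one gives the left
    side, the other the product. *)
Lemma integral_det_transfer m (X : T -> 'M[R[i]]_(1 + m)) k :
  mxmeasurable X -> (forall x, X x \is unitarymx) -> left_invariant mu X ->
  (\int[mu]_x (normc (det1B (X x)) ^+ k)%:E =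
   \int[mu]_x (normc (1 - X x 0 0) ^+ k)%:E *
   \int[mu]_x (normc (det1B (transfer (X x))) ^+ k)%:E)%E.
Proof.
move=> mX XU Xinv.
pose f (A : 'M[R[i]]_m) : R := normc (det1B A) ^+ k.
pose G (z : T * T) := (normc (1 - X z.1 0 0) ^+ k *
  f (transfer (X z.2) *m transfer (X z.1)))%:E.
have mX1 : mxmeasurable (fun z : T * T => X z.1).
  move=> i j; have [mr mi] := mX i j; split.
    exact: (measurableT_comp mr measurable_fst).
  exact: (measurableT_comp mi measurable_fst).
have mX2 : mxmeasurable (fun z : T * T => X z.2).
  move=> i j; have [mr mi] := mX i j; split.
    exact: (measurableT_comp mr measurable_snd).
  exact: (measurableT_comp mi measurable_snd).
have mcorner d' (T' : measurableType d') (Y : T' -> 'M[R[i]]_(1 + m)) :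
    mxmeasurable Y -> measurable_fun setT (fun x => normc (1 - Y x 0 0) ^+ k).
  move=> mY; apply: measurable_funX; apply: measurable_normc.
  apply: cmeasurableD; first exact: cmeasurable_cst.
  by apply: cmeasurableN; exact: mY.
have f0 A : 0 <= f A by rewrite /f exprn_ge0// normc_ge0.
have mG : measurable_fun setT G.
  apply/measurable_EFinP; apply: measurable_funM; first exact: mcorner.
  apply: normc_det1B_borel.
  by apply: mxmeasurableM; exact: mxmeasurable_transfer.
have G0 z : (0 <= G z)%E by rewrite lee_fin mulr_ge0// exprn_ge0// normc_ge0.
have tU x : transfer (X x) \is unitarymx by exact/transfer_unitary/XU.
(* For fixed [y], [G (x, y)] is the [k]-th power of [|det (1 - diag(1, t(X y)) X x)|], where [t] is
   [transfer]; left invariance in [x] removes the block matrix. *)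
transitivity (\int[mu]_y \int[mu]_x G (x, y))%E.
  transitivity (\int[mu]_(y in setT) \int[mu]_x (normc (det1B (X x)) ^+ k)%:E)%E.
    rewrite integral_cst//= probability_setT mule1//.
  apply: eq_integral => y _.
  rewrite -(Xinv _ _ (@normc_det1B_borel _ k) _ (block1_unitary (tU y))); last first.
    by move=> A; rewrite exprn_ge0// normc_ge0.
  apply: eq_integral => x _; rewrite /G /= det1B_transfer; last first.
    by rewrite mul_unitarymx// block1_unitary.
  rewrite transfer_mulmx Normc.normcM exprMn; congr (normc (1 - _) ^+ _ * _)%:E.
  have -> : 0 = lshift m (0 : 'I_1) :> 'I_(1 + m) by exact: val_inj.
  by rewrite -[X x]submxK mulmx_block mul1mx mul0mx addr0 !block_mxEul.
rewrite -(@fubini_tonelli _ _ _ _ _ mu mu G)//.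
have fC (a b : 'M[R[i]]_m) : a \is unitarymx -> f (a *m b) = f (b *m a).
  by move=> aU; rewrite /f det1B_mulC//; exact: unitarymx_unit.
(* For fixed [x], [fC] moves the factor [transfer (X x)] to the left, where invariance of
   [transfer (X y)] absorbs it. *)
have Einv x : (\int[mu]_y (f (transfer (X y) *m transfer (X x)))%:E =
    \int[mu]_y (f (transfer (X y)))%:E)%E.
  apply: etrans (left_invariant_transfer Xinv (@normc_det1B_borel m k) f0 (tU x)).
  by apply: eq_integral => y _; exact: (congr1 EFin (fC _ _ (tU y))).
have mf : measurable_fun setT (fun y => f (transfer (X y))).
  by apply: normc_det1B_borel; exact: mxmeasurable_transfer.
rewrite -ge0_integralZr//; last 3 first.
- by apply/measurable_EFinP; exact: mcorner.
- by move=> x _; rewrite lee_fin exprn_ge0// normc_ge0.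
- by apply: integral_ge0 => y _; rewrite lee_fin exprn_ge0// normc_ge0.
apply: eq_integral => x _; rewrite -(Einv x) -ge0_integralZl//; last 3 first.
- apply/measurable_EFinP; apply: normc_det1B_borel.
  by apply: mxmeasurableM; [exact: mxmeasurable_transfer|exact: mxmeasurable_cst].
- by move=> y _; rewrite lee_fin exprn_ge0// normc_ge0.
- by rewrite lee_fin exprn_ge0// normc_ge0.
Qed.

End Factorization.

(** * Haar measure as a left-invariant law *)

Lemma Re_continuous (R : realType) : continuous (fun z : R[i] => complex.Re z).
Proof.
move=> z A /nbhs_ballP[e e0 eA]; exists e%:C%C; first by rewrite /= ltcR.
move=> w /= zw; apply: eA; rewrite /ball/=; move: zw.
rewrite normc_def ltcR; apply: le_lt_trans.
rewrite -[leLHS]sqrtr_sqr; case: z w => [a b] [c d] /=.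
by rewrite ler_wsqrtr// lerDl sqr_ge0.
Qed.

Lemma Im_continuous (R : realType) : continuous (fun z : R[i] => complex.Im z).
Proof.
move=> z A /nbhs_ballP[e e0 eA]; exists e%:C%C; first by rewrite /= ltcR.
move=> w /= zw; apply: eA; rewrite /ball/=; move: zw.
rewrite normc_def ltcR; apply: le_lt_trans.
rewrite -[leLHS]sqrtr_sqr; case: z w => [a b] [c d] /=.
by rewrite ler_wsqrtr// lerDr sqr_ge0.
Qed.

Section HaarBase.
Variables (R : realType) (n : nat) (mu : probability (borel_unitary R n) R).
Local Notation X := (fun g : borel_unitary R n => \val (g : unitary R n)).

Lemma entry_continuous (i j : 'I_n) :
  continuous (fun g : unitary R n => \val g i j).
Proof.
move=> g; apply: (@continuous_comp _ _ _ (\val : unitary R n -> 'M[R[i]]_n)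
  (fun A => A i j)); first exact: initial_continuous.
exact: (@coord_continuous R[i]).
Qed.

Lemma continuous_borel_measurable (F : unitary R n -> R) : continuous F ->
  measurable_fun setT (F : borel_unitary R n -> R).
Proof.
move=> /continuousP cF; apply: (measurability _ (RGenOpens.measurableE R)).
move=> _ [_ [a [b ->] <-]]; rewrite setTI; apply: sub_sigma_algebra.
exact/cF/interval_open.
Qed.

Lemma unitary_mxmeasurable : mxmeasurable X.
Proof.
move=> i j; split; apply: continuous_borel_measurable => g.
  apply: (@continuous_comp _ _ _ (fun g : unitary R n => \val g i j)
    (fun z : R[i] => complex.Re z)); first exact: entry_continuous.
  exact: Re_continuous.
apply: (@continuous_comp _ _ _ (fun g : unitary R n => \val g i j)
  (fun z : R[i] => complex.Im z)); first exact: entry_continuous.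
exact: Im_continuous.
Qed.

(** Invariance on sets says that [f (h g)] and [f g] have the same law on the real line, hence the
    same mean. *)
Lemma haar_left_invariant : haar_probability mu -> left_invariant mu X.
Proof.
move=> hmu f h mf f0 hU.
pose h1 : unitary R n := Sub h hU.
have mf1 : measurable_fun setT (fun g : borel_unitary R n => f (X g)).
  by apply: mf; exact: unitary_mxmeasurable.
have mf2 : measurable_fun setT (fun g : borel_unitary R n => f (h *m X g)).
  apply: mf; apply: mxmeasurableM; first exact: mxmeasurable_cst.
  exact: unitary_mxmeasurable.
have f0' : {in setT, forall y : R, (0 <= `|y|%:E)%E} by move=> y _; rewrite lee_fin.
have mabs : measurable_fun [set: R] (fun y : R => `|y|%:E).
  by apply/measurable_EFinP; exact: normr_measurable.
(* The integrand [|y|] stands for [y]: it is nonnegative on the whole line and agrees with [y] on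
   the values of [f]. *)
transitivity (\int[pushforward mu (fun g : borel_unitary R n => f (h *m X g))]_y
   `|y|%:E)%E.
  rewrite (ge0_integral_pushforward mf2)//=.
  by apply: eq_integral => g _ /=; rewrite ger0_norm.
transitivity (\int[pushforward mu (fun g : borel_unitary R n => f (X g))]_y
   `|y|%:E)%E; last first.
  rewrite (ge0_integral_pushforward mf1)//=.
  by apply: eq_integral => g _ /=; rewrite ger0_norm.
apply: eq_measure_integral => A mA _; rewrite /pushforward.
have mA2 : measurable ((fun g : borel_unitary R n => f (h *m X g)) @^-1` A).
  by rewrite -[Y in measurable Y]setTI; exact: mf2.
(* Translating [{g | f (h g) \in A}] by [h] gives [{g | f g \in A}]. *)
apply: etrans (esym (hmu h1 _ mA2)) _; congr (mu _).
apply/seteqP; split => [_ [g Ag <-]|g Ag].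
  exact: Ag.
exists (h1^-1 * g)%g; last by rewrite mulVKg.
have : A (f (\val (h1 * (h1^-1 * g))%g)) by rewrite mulVKg.
by [].
Qed.

End HaarBase.

(** * Moments of the corner entry *)

Lemma normc_norm (R : rcfType) (z : R[i]) : (normc z)%:C%C = `|z|.
Proof. by []. Qed.

Lemma normc_nat (R : rcfType) n : normc (n%:R : R[i]) = n%:R.
Proof. by apply: complexI; rewrite normc_norm normr_nat rmorph_nat. Qed.

Lemma normc_real (R : rcfType) (r : R) : normc r%:C%C = `|r|.
Proof. by rewrite /= expr0n addr0 sqrtr_sqr. Qed.

Lemma mean_normc_rotation (R : realType) N (w x y : R[i]) k :
  (k < N)%N -> N.-primitive_root w ->
  \sum_(j < N) normc (w ^+ j * x + y) ^+ (2 * k) =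
  N%:R * \sum_(i < k.+1)
    'C(k, i)%:R ^+ 2 * (normc x ^+ (2 * i) * normc y ^+ (2 * (k - i))).
Proof.
move=> kN wN; apply: (@complexI R).
rewrite rmorph_sum rmorphM rmorph_nat rmorph_sum /=.
under eq_bigr do rewrite rmorphXn /=.
rewrite [LHS](mean_norm_rotation x y kN wN); congr (_ * _).
by apply: eq_bigr => i _; rewrite !(rmorphM, rmorphXn) /= rmorph_nat.
Qed.

Lemma normc_det_subC (R : realType) n (A : 'M[R[i]]_n) :
  normc (\det (A - 1%:M)) = normc (det1B A).
Proof.
rewrite /det1B -opprB -scaleN1r detZ Normc.normcM.
have -> : normc ((-1) ^+ n : R[i]) = 1.
  by apply: complexI; rewrite normc_norm normrX normrN1 expr1n.
by rewrite mul1r.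
Qed.

(** Each term is [k! m! / (m + k)!] times ['C(k, i) * 'C(m + k, k - i)], and Vandermonde sums these
    products to ['C(m + 2k, k)]. *)
Lemma sum_bin2_fact (F : numFieldType) m k :
  \sum_(i < k.+1) 'C(k, i)%:R ^+ 2 * ((i`! * m`!)%:R / (m + i)`!%:R) =
  (m`! * (m + 2 * k)`!)%:R / (m + k)`!%:R ^+ 2 :> F.
Proof.
have fact0 i : i`!%:R != 0 :> F by rewrite pnatr_eq0 -lt0n fact_gt0.
transitivity (\sum_(i < k.+1) (k`! * m`!)%:R / (m + k)`!%:R *
    ('C(k, i) * 'C(m + k, k - i))%:R : F).
  apply: eq_bigr => i _; have ik : (i <= k)%N by rewrite -ltnS.
  have H1 : ('C(k, i) * (i`! * (k - i)`!) = k`!)%N by rewrite bin_fact.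
  have H2 : ('C(m + k, k - i) * ((k - i)`! * (m + i)`!) = (m + k)`!)%N.
    rewrite -[RHS](@bin_fact _ (k - i)); last first.
      by rewrite (leq_trans (leq_subr _ _))// leq_addl.
    by congr (_ * (_ * _`!))%N; rewrite -addnBA ?leq_subr// subKn.
  rewrite -H2 -H1 !natrM.
  have b0 : 'C(m + k, k - i)%:R != 0 :> F.
    by rewrite pnatr_eq0 -lt0n bin_gt0 (leq_trans (leq_subr _ _))// leq_addl.
  by field; rewrite !fact0 b0.
rewrite -mulr_sumr -natr_sum binomial.Vandermonde.
have <- : ('C(k + (m + k), k) * (k`! * (m + k)`!) = (m + 2 * k)`!)%N.
  by rewrite -[X in (_ * (_ * X`!))%N](addKn k) bin_fact ?leq_addr// addnCA mul2n addnn.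
by rewrite !natrM; field; rewrite fact0.
Qed.

Definition cmx_borel (R : realType) m n (a : 'M[R[i]]_(m, n) -> R[i]) :=
  forall d (T : measurableType d) (X : T -> 'M[R[i]]_(m, n)),
    mxmeasurable X -> cmeasurable (fun x => a (X x)).

Section Moments.
Variables (R : realType) (d : measure_display) (T : measurableType d).
Variables (mu : probability T R) (m : nat) (X : T -> 'M[R[i]]_(1 + m)).
Hypothesis mX : mxmeasurable X.
Hypothesis XU : forall x, X x \is unitarymx.
Hypothesis Xinv : left_invariant mu X.
Local Notation C := R[i].
Implicit Types A : 'M[C]_(1 + m).

Let normcX_ge0 (z : C) k : 0 <= normc z ^+ k.
Proof. by rewrite exprn_ge0// normc_ge0. Qed.

(** A phase on the first row rotates [a] and fixes [b], so the integral equals its average over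
    [N > k] rotations, in which the mixed terms cancel. *)
Lemma integral_rotation (a b : 'M[C]_(1 + m) -> C) k :
  cmx_borel a -> cmx_borel b ->
  (forall w A, `|w| = 1 -> a (phase_mx m w *m A) = w * a A) ->
  (forall w A, `|w| = 1 -> b (phase_mx m w *m A) = b A) ->
  (\int[mu]_x (normc (a (X x) + b (X x)) ^+ (2 * k))%:E =
   \sum_(i < k.+1) ('C(k, i)%:R ^+ 2)%:E *
     \int[mu]_x (normc (a (X x)) ^+ (2 * i) * normc (b (X x)) ^+ (2 * (k - i)))%:E)%E.
Proof.
move=> ma mb aw bw; pose N := (2 ^ k.+1)%N.
have [w wN] := prim_root_2exp R[i] k; rewrite -/N in wN.
have N0 : (0 < N)%N by rewrite expn_gt0.
have w1 := norm_prim_root N0 wN.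
have kN : (k < N)%N by rewrite (ltn_trans (ltnSn k))// ltn_expl.
have mab i : measurable_fun setT (fun x =>
    (normc (a (X x)) ^+ (2 * i) * normc (b (X x)) ^+ (2 * (k - i)))%:E).
  apply/measurable_EFinP; apply: measurable_funM; apply: measurable_funX;
    apply: measurable_normc; [exact: ma|exact: mb].
have -> : (\sum_(i < k.+1) ('C(k, i)%:R ^+ 2)%:E *
     \int[mu]_x (normc (a (X x)) ^+ (2 * i) * normc (b (X x)) ^+ (2 * (k - i)))%:E =
   \int[mu]_x (\sum_(j < N) (N%:R^-1)%:E *
     (normc (w ^+ j * a (X x) + b (X x)) ^+ (2 * k))%:E))%E.
  under eq_bigr => i _.
    rewrite -ge0_integralZl//; last first.
      by move=> x _; rewrite lee_fin mulr_ge0.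
    over.
  rewrite -ge0_integral_sum//; last 2 first.
  - by move=> i; exact: measurable_funeM.
  - by move=> i x _; rewrite -EFinM lee_fin !mulr_ge0.
  apply: eq_integral => x _; rewrite !sumEFin; congr EFin.
  by rewrite -mulr_sumr mean_normc_rotation// mulKf// pnatr_eq0 -lt0n.
have mj j : measurable_fun setT (fun x =>
    (normc (w ^+ j * a (X x) + b (X x)) ^+ (2 * k))%:E).
  apply/measurable_EFinP; apply: measurable_funX; apply: measurable_normc.
  apply: cmeasurableD; last exact: mb.
  by apply: cmeasurableM; [exact: cmeasurable_cst|exact: ma].
rewrite ge0_integral_sum//; last 2 first.
- by move=> j; exact: measurable_funeM.
- by move=> j x _; rewrite -EFinM lee_fin mulr_ge0.
(* By phase invariance each of the [N] summands is [I / N]. *)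
set I := LHS; under eq_bigr => j _.
  rewrite ge0_integralZl//; last first.
    by move=> x _; rewrite lee_fin.
  have -> : (\int[mu]_x (normc (w ^+ j * a (X x) + b (X x)) ^+ (2 * k))%:E = I)%E.
    have wj1 : `|w ^+ j| = 1 by rewrite normrX w1 expr1n.
    rewrite /I -(Xinv (f := fun A => normc (a A + b A) ^+ (2 * k)) _ _
      (phase_unitary m wj1))//.
      by apply: eq_integral => x _; rewrite aw// bw.
    move=> d' T' Y mY; apply: measurable_funX; apply: measurable_normc.
    by apply: cmeasurableD; [exact: ma|exact: mb].
  over.
rewrite -ge0_sume_distrl//= sumEFin sumr_const card_ord -[_ *+ _]mulr_natr.
by rewrite mulVf ?mul1e// pnatr_eq0 -lt0n.
Qed.

Lemma cmx_borel_cst (c : C) : cmx_borel (fun _ : 'M[C]_(1 + m) => c).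
Proof. by move=> d' T' Y _; exact: cmeasurable_cst. Qed.

Lemma cmx_borel_entry i j : cmx_borel (fun A : 'M[C]_(1 + m) => A i j).
Proof. by move=> d' T' Y; apply. Qed.

Lemma cmx_borelM (a b : 'M[C]_(1 + m) -> C) :
  cmx_borel a -> cmx_borel b -> cmx_borel (fun A => a A * b A).
Proof. by move=> ma mb d' T' Y mY; apply: cmeasurableM; [exact: ma|exact: mb]. Qed.

Lemma normc_col_norm2 (A : 'M[C]_(1 + m)) : A \is unitarymx ->
  \sum_i normc (A i 0) ^+ 2 = 1.
Proof.
move=> AU; apply: (@complexI R); rewrite rmorph_sum rmorph1.
rewrite -(unitary_col_norm2 0 AU); apply: eq_bigr => i _.
by rewrite rmorphXn.
Qed.

Lemma normc_entry_le1 (A : 'M[C]_(1 + m)) i : A \is unitarymx -> normc (A i 0) <= 1.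
Proof.
move=> AU; rewrite -(@ler_pXn2r _ 2)// ?nnegrE ?normc_ge0// expr1n.
rewrite -(normc_col_norm2 AU) (bigD1 i)//= lerDl.
by apply: sumr_ge0 => j _; rewrite normcX_ge0.
Qed.

Definition moment i p q : R :=
  fine (\int[mu]_x (normc (X x 0 0) ^+ (2 * p) * normc (X x i 0) ^+ (2 * q))%:E)%E.

Lemma measurable_moment i p q : measurable_fun setT (fun x =>
  (normc (X x 0 0) ^+ (2 * p) * normc (X x i 0) ^+ (2 * q))%:E).
Proof.
apply/measurable_EFinP; apply: measurable_funM; apply: measurable_funX;
  by apply: measurable_normc; exact: mX.
Qed.

(** Entries of a unitary matrix have modulus at most 1, so the integral is at most 1 and [fine]
    loses nothing. *)
Lemma momentE i p q :
  (\int[mu]_x (normc (X x 0 0) ^+ (2 * p) * normc (X x i 0) ^+ (2 * q))%:E =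
   (moment i p q)%:E)%E.
Proof.
rewrite /moment fineK// ge0_fin_numE; last first.
  by apply: integral_ge0 => x _; rewrite lee_fin mulr_ge0.
apply: (@le_lt_trans _ _ (\int[mu]_(x in setT) (cst 1%E x))%E); last first.
  by rewrite integral_cst//= probability_setT mule1 ltry.
apply: ge0_le_integral => //.
- by move=> x _; rewrite lee_fin mulr_ge0.
- exact: measurable_moment.
- move=> x _; rewrite lee_fin mulr_ile1// exprn_ile1// ?normc_ge0//;
    exact: normc_entry_le1.
Qed.

Lemma moment0E p :
  (\int[mu]_x (normc (X x 0 0) ^+ (2 * p))%:E = (moment 0 p 0)%:E)%E.
Proof. by rewrite -momentE; apply: eq_integral => x _; rewrite expr0 mulr1. Qed.

Lemma moment_i0 i p : moment i p 0 = moment 0 p 0.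
Proof.
by apply: EFin_inj; rewrite -!momentE; apply: eq_integral => x _; rewrite !expr0.
Qed.

Lemma integral_reflection l (n k : nat) :
  (\int[mu]_x (normc ((1 - n%:R ^+ 2) * X x 0 0 + 2 * n%:R * X x (rshift 1 l) 0)
     ^+ (2 * k))%:E = ((1 + n%:R ^+ 2) ^+ (2 * k) * moment 0 k 0)%:E)%E.
Proof.
rewrite EFinM -moment0E -(Xinv (f := fun A => normc (A 0 0) ^+ (2 * k)) _ _
  (reflection_unitary _ l n))//; last first.
  by move=> d' T' Y mY; apply: measurable_funX; apply: measurable_normc; exact: mY.
rewrite -ge0_integralZl//; last 2 first.
- apply/measurable_EFinP; apply: measurable_funX; apply: measurable_normc.
  by apply: mxmeasurableM => //; exact: mxmeasurable_cst.
- by move=> x _; rewrite lee_fin.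
apply: eq_integral => x _; rewrite -EFinM; congr EFin.
rewrite -normcN -reflection_mx0 Normc.normcM exprMn; congr (_ ^+ _ * _).
by rewrite -!natrX -!(natrD _ 1) normc_nat.
Qed.

(** Expanding [integral_reflection] by [integral_rotation] yields the hypothesis of [rotation_coef],
    with parameter [n ^ 2] and [|2 n|^2 = 4 n^2]. *)
Lemma moment_step l j : j.+1%:R * moment (rshift 1 l) j 1 = moment 0 j.+1 0.
Proof.
have := @rotation_coef R (fun i => moment (rshift 1 l) i (j.+1 - i)) j.
rewrite subnn subSnn moment_i0; apply => n b.
apply: EFin_inj; rewrite /b natrX -(integral_reflection l).
rewrite (@integral_rotation (fun A => (1 - n%:R ^+ 2) * A 0 0)
  (fun A => 2 * n%:R * A (rshift 1 l) 0)); last 4 first.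
- by apply: cmx_borelM; [exact: cmx_borel_cst|exact: cmx_borel_entry].
- by apply: cmx_borelM; [exact: cmx_borel_cst|exact: cmx_borel_entry].
- by move=> w A _; rewrite phase_mx0 mulrCA.
- by move=> w A _; rewrite phase_mxr.
rewrite -sumEFin; apply: eq_bigr => i _; rewrite EFinM; congr (_ * _)%E.
rewrite EFinM -momentE -ge0_integralZl//; last 3 first.
- exact: measurable_moment.
- by move=> x _; rewrite lee_fin mulr_ge0.
- by rewrite lee_fin mulr_ge0// exprM exprn_ge0// sqr_ge0.
apply: eq_integral => x _; rewrite -EFinM; congr EFin.
rewrite !Normc.normcM !exprMn mulrACA; congr (_ * _ * (_ * _)).
  have -> : 1 - n%:R ^+ 2 = (1 - n%:R ^+ 2 : R)%:C%C :> C.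
    by rewrite rmorphB rmorph1 rmorphXn rmorph_nat.
  by rewrite normc_real -normrX ger0_norm// exprM exprn_ge0// sqr_ge0.
rewrite !normc_nat !exprM; congr (_ * _); last by rewrite -exprMn.
by congr (_ ^+ _); rewrite -natrX.
Qed.

(** The squared norm 1 of the first column is inserted into the integrand. *)
Lemma moment_sum p : moment 0 p 0 = \sum_i moment i p 1.
Proof.
apply: EFin_inj; rewrite -moment0E -sumEFin.
under [RHS]eq_bigr do rewrite -momentE.
rewrite -ge0_integral_sum//; last 2 first.
- by move=> i; exact: measurable_moment.
- by move=> i x _; rewrite lee_fin mulr_ge0.
apply: eq_integral => x _; rewrite sumEFin -mulr_sumr; congr EFin.
by under eq_bigr do rewrite muln1; rewrite normc_col_norm2 ?mulr1.
Qed.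

Lemma moment00 : moment 0 0 0 = 1.
Proof.
apply: EFin_inj; rewrite -moment0E; under eq_integral do rewrite expr0.
by rewrite integral_cst//= probability_setT mule1.
Qed.

(** In [moment_sum] the corner contributes [moment 0 p.+1 0], and by [moment_step] each of the [m]
    other entries contributes that value over [p.+1]. *)
Lemma momentS p : (m + p.+1)%:R * moment 0 p.+1 0 = p.+1%:R * moment 0 p 0.
Proof.
rewrite (moment_sum p) big_split_ord big_ord1 mulrDr mulr_sumr /=.
under eq_bigr do rewrite moment_step.
rewrite sumr_const card_ord natrD mulrDl addrC; congr (_ + _); last by rewrite mulr_natl.
congr (_ * _); apply: EFin_inj; rewrite -!momentE; apply: eq_integral => x _.
rewrite (_ : lshift m 0 = 0); last exact: val_inj.
by rewrite -!exprD -!mulnDr addn0 addn1.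
Qed.

Lemma momentE_fact p : moment 0 p 0 = (p`! * m`!)%:R / (m + p)`!%:R.
Proof.
elim: p => [|p IH].
  by rewrite moment00 mul1n addn0 divff ?pnatr_eq0 -?lt0n ?fact_gt0.
have mp0 : (m + p.+1)%:R != 0 :> R by rewrite pnatr_eq0 addnS.
apply: (mulfI mp0); rewrite momentS IH addnS !factS !natrM -addnS.
by field; rewrite pnatr_eq0 -lt0n fact_gt0 -!(natrD _ 1) -natrD pnatr_eq0 addnS.
Qed.

Lemma integral_corner k :
  (\int[mu]_x (normc (1 - X x 0 0) ^+ (2 * k))%:E =
   ((m`! * (m + 2 * k)`!)%:R / (m + k)`!%:R ^+ 2)%:E)%E.
Proof.
(* The rotating part is [- X x 0 0] and the fixed part is the constant 1. *)
have -> : (\int[mu]_x (normc (1 - X x 0 0) ^+ (2 * k))%:E =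
   \int[mu]_x (normc (- 1 * X x 0 0 + 1) ^+ (2 * k))%:E)%E.
  by apply: eq_integral => x _; rewrite mulN1r addrC.
rewrite (@integral_rotation (fun A => - 1 * A 0 0) (fun=> 1)); last 4 first.
- by apply: cmx_borelM; [exact: cmx_borel_cst|exact: cmx_borel_entry].
- exact: cmx_borel_cst.
- by move=> w A _; rewrite phase_mx0 mulrCA.
- by [].
under eq_bigr => i _.
  have -> : (\int[mu]_x (normc (- 1 * X x 0 0) ^+ (2 * i) * normc 1 ^+ (2 * (k - i)))%:E =
     (moment 0 i 0)%:E)%E.
    rewrite -moment0E; apply: eq_integral => x _.
    by rewrite mulN1r normcN Normc.normc1 expr1n mulr1.
  rewrite momentE_fact -EFinM; over.
rewrite sumEFin; congr EFin; exact: sum_bin2_fact.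
Qed.

End Moments.

(** Induction on the size, for any left-invariant random unitary matrix because the step replaces
    [X] by [transfer (X x)]. Passing from size [m] to [m.+1] adds the factor [j = m]. *)
Lemma integral_det1B (R : realType) d (T : measurableType d) (mu : probability T R)
    k m (X : T -> 'M[R[i]]_m) :
  mxmeasurable X -> (forall x, X x \is unitarymx) -> left_invariant mu X ->
  (\int[mu]_x (normc (det1B (X x)) ^+ (2 * k))%:E =
   (\prod_(0 <= j < m) ((j`! * (j + 2 * k)`!)%:R / (j + k)`!%:R ^+ 2))%:E)%E.
Proof.
elim: m X => [|m IH] X mX XU Xinv.
  under eq_integral do rewrite /det1B det_mx00 Normc.normc1 expr1n.
  by rewrite big_geq// integral_cst//= probability_setT mule1.
rewrite (@integral_det_transfer _ _ _ _ m X)// integral_corner// IH; last 3 first.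
- exact: mxmeasurable_transfer.
- by move=> x; exact/transfer_unitary/XU.
- exact: left_invariant_transfer.
by rewrite big_nat_recr//= -EFinM mulrC.
Qed.

Theorem corollary1 (R : realType) (n k : nat) (hn : (1 <= n)%N)
    (mu : probability (borel_unitary R n) R) (hmu : haar_probability mu) :
  (\int[mu]_(g in [set: borel_unitary R n])
     (Normc.normc (\det (\val (g : unitary R n) - 1%:M)) ^+ (2 * k))%:E =
   (\prod_(0 <= j < n)
      ((j`! * (j + 2 * k)`!)%:R / ((j + k)`!%:R ^+ 2)))%:E)%E.
Proof.
(* The random matrix is the group element itself; [g - 1] and [1 - g] have determinants of equal
   modulus. *)
rewrite -(integral_det1B k (@unitary_mxmeasurable R n) _ (haar_left_invariant hmu)).
  apply: eq_integral => g _.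
  exact: (congr1 (fun r => (r ^+ (2 * k))%:E) (normc_det_subC _)).
by move=> g; exact: valP.
Qed.
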